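(* Let $1<p<\infty$ and $p'=p/(p-1)$. Then $$V_p=\bigcap_{\Lambda\in\mathcal{S}_{p'}}\Lambda BV.$$
   Context: $\mathcal{S}$ denotes the collection of all positive nondecreasing sequences $\Lambda=\{\lambda_n\}_{n\ge1}$ of real numbers such that $\lambda_n\to\infty$ and $\sum_{n=1}^\infty 1/\lambda_n=\infty$. $\mathcal{S}_{p'}$ denotes the class of all $\Lambda=\{\lambda_n\}\in\mathcal{S}$ such that $$\sum_{n=1}^\infty\left(\frac{1}{\lambda_n}\right)^{p'}<\infty.$$ For a 1-periodic function $f$ on the real line and an interval $I=[a,b]$, set $f(I)=f(b)-f(a)$. Below, suprema are taken over all (finite or infinite) sequences $\mathcal{I}=\{I_n\}$ of nonoverlapping intervals contained in a period (i.e. contained in a common interval of length 1). For $\Lambda=\{\lambda_n\}\in\mathcal{S}$, the class $\Lambda BV$ consists of all 1-periodic functions $f$ such that $$v_\Lambda(f)=\sup_{\mathcal{I}}\sum_{n}\frac{|f(I_n)|}{\lambda_n}<\infty.$$ The class $V_p$ of functions of bounded $p$-variation consists of all 1-periodic functions $f$ such that $$v_p(f)=\sup_{\mathcal{I}}\left(\sum_{n}|f(I_n)|^p\right)^{1/p}<\infty.$$ *)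

(* Defs.v *)
From HB Require Import structures.
From mathcomp Require Import all_boot all_order all_algebra.
From mathcomp Require Import all_classical all_reals all_analysis.

Set Implicit Arguments.
Unset Strict Implicit.
Unset Printing Implicit Defensive.

Import Order.TTheory GRing.Theory Num.Theory.
Import numFieldNormedType.Exports.

Local Open Scope classical_set_scope.
Local Open Scope ring_scope.

(* Sequences (lambda_n)_{n >= 1} and (I_n)_{n >= 1} are indexed from 0:
   [L n] stands for lambda_{n+1}. *)

Definition classS {R : realType} : set (nat -> R) :=
  [set L | [/\ forall n, 0 < L n,
               nondecreasing_seq L,
               L n @[n --> \oo] --> +oo &
               (\sum_(0 <= n <oo) ((L n)^-1)%:E = +oo)%E]].

Definition classS_ {R : realType} (q : R) : set (nat -> R) :=
  [set L | classS L /\ (\sum_(0 <= n <oo) ((L n)^-1 `^ q)%:E < +oo)%E].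

(* [Some N] is the length of a finite sequence, [None] that of an infinite
   one; [in_range len n] says that the n-th term exists. *)
Definition in_range (len : option nat) (n : nat) : bool :=
  if len is Some N then (n < N)%N else true.

(* The values of [lpt] and [rpt] at indices out of range are irrelevant. *)
Record interval_seq (R : realType) := IntervalSeq {
  len : option nat ;
  lpt : nat -> R ;
  rpt : nat -> R
}.

Definition nonoverlapping_in_period {R : realType} (I : interval_seq R) : Prop :=
  [/\ forall n, in_range (len I) n -> lpt I n < rpt I n,
      trivIset [set n | in_range (len I) n]
               (fun n => `]lpt I n, rpt I n[%classic) &
      exists c : R, forall n, in_range (len I) n ->
        `[lpt I n, rpt I n]%classic `<=` `[c, c + 1]%classic].

Definition incr {R : realType} (f : R -> R) (I : interval_seq R) (n : nat) : R :=
  f (rpt I n) - f (lpt I n).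

Definition v_Lambda {R : realType} (L : nat -> R) (f : R -> R) : \bar R :=
  ereal_sup [set (\sum_(0 <= n <oo | in_range (len I) n)
                    (`|incr f I n| / L n)%:E)%E
            | I in [set I | nonoverlapping_in_period I]].

Definition v_p {R : realType} (p : R) (f : R -> R) : \bar R :=
  ereal_sup [set ((\sum_(0 <= n <oo | in_range (len I) n)
                     (`|incr f I n| `^ p)%:E) `^ p^-1)%E
            | I in [set I | nonoverlapping_in_period I]].

Definition LambdaBV {R : realType} (L : nat -> R) : set (R -> R) :=
  [set f | periodic f 1 /\ (v_Lambda L f < +oo)%E].

Definition V_ {R : realType} (p : R) : set (R -> R) :=
  [set f | periodic f 1 /\ (v_p p f < +oo)%E].

(* Main.v *)
Require Import Defs.
From mathcomp Require Import all_boot all_order all_algebra.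
From mathcomp Require Import all_classical all_reals all_analysis.
From mathcomp Require Import ring lra.

Set Implicit Arguments.
Unset Strict Implicit.
Unset Printing Implicit Defensive.

Import Order.TTheory GRing.Theory Num.Theory.

Local Open Scope classical_set_scope.
Local Open Scope ring_scope.

(** Write q = p', so that 1/p + 1/q = 1.

    The inclusion of V_p in every Lambda BV is Hoelder's inequality. Since only
    finiteness is at stake, its pointwise form (Young's inequality) is enough:
    |f(I_n)| / lambda_n <= |f(I_n)|^p / p + (1 / lambda_n)^q / q, and both terms
    on the right have sums bounded independently of the intervals.

    For the converse, suppose that v_p(f) is infinite. The classes Lambda BV do
    not require one system of intervals to witness an infinite sum: it suffices
    to find one Lambda for which systems with arbitrarily large weighted sums
    exist. Choose for each k a finite system I^k with
    A_k = sum_n a_(k,n)^p at least 4^((k+1) p), where a_(k,n) = |f(I^k_n)|.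
    The Hoelder-dual weight of a_k is b_(k,n) = (a_(k,n)^p / A_k)^(1/q): it has
    unit norm in l^q, and sum_n a_(k,n) b_(k,n) = A_k^(1/p). The weights 1 / lambda
    are obtained by superposing all of these with the coefficients 2^-(k+1), at
    the level of q-th powers, where the superposition is linear:

      (1 / lambda_n)^q = sum_k 2^-(k+1) a_(k,n)^p / A_k + (n+1)^-q.

    The right-hand side is summable because the inner sums over n are 1 and
    q > 1. The last term forces lambda_n <= n + 1, so that sum_n 1 / lambda_n
    diverges. Finally the k-th system has weighted sum at least
    2^-(k+1) A_k^(1/p) >= 2^(k+1). The monotonicity of Lambda comes from listing
    every I^k in order of nonincreasing |f(I^k_n)|, which is possible since the
    systems are finite and the p-variation does not see the order.

    The construction of Lambda is [exists_dual_weight], the choice of the systems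
    is [large_p_sum], and Young's inequality enters in [V_sub_LambdaBV]. *)

(** * Series of nonnegative terms and the p-series *)

Lemma nneseries_le_fin (R : realType) (u : nat -> R) (P : pred nat) (C : R) :
  (forall n, 0 <= u n) ->
  (forall N, \sum_(0 <= n < N | P n) u n <= C) ->
  (\sum_(0 <= n <oo | P n) (u n)%:E <= C%:E)%E.
Proof.
move=> u0 uC; apply: lime_le.
  by apply: is_cvg_nneseries => n _ _; rewrite lee_fin.
by apply: nearW => N; rewrite sumEFin lee_fin.
Qed.

Lemma sum_le_nneseries (R : realType) (u : nat -> R) (P : pred nat) (N : nat) :
  (forall n, 0 <= u n) ->
  ((\sum_(0 <= n < N | P n) u n)%:E <= \sum_(0 <= n <oo | P n) (u n)%:E)%E.
Proof.
move=> u0; rewrite -sumEFin; apply: nneseries_lim_ge => n _ _.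
by rewrite lee_fin.
Qed.

Lemma nneseries_harmonic (R : realType) :
  (\sum_(0 <= n <oo) (n.+1%:R^-1 : R)%:E = +oo)%E.
Proof.
apply/eqP; rewrite -leye_eq leNgt; apply/negP => sum_lt.
have h0 n : 0 <= (n.+1%:R^-1 : R) by rewrite invr_ge0.
have sum_ge0 : (0 <= \sum_(0 <= n <oo) (n.+1%:R^-1 : R)%:E)%E.
  by apply: nneseries_ge0 => n _ _; rewrite lee_fin.
apply: (@dvg_harmonic R); apply: nondecreasing_is_cvgn.
  by apply: nondecreasing_series => n _ _; exact: h0.
exists (fine (\sum_(0 <= n <oo) (n.+1%:R^-1 : R)%:E)%E) => _ [N _ <-].
rewrite -lee_fin fineK ?ge0_fin_numE//.
exact: sum_le_nneseries.
Qed.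

Lemma nonincreasing_riemannR (R : realType) (q : R) : 0 <= q ->
  nonincreasing_seq (riemannR q).
Proof.
move=> q0 m n mn; rewrite /riemannR lef_pV2 ?posrE ?powR_gt0//.
by rewrite ge0_ler_powR ?nnegrE// ler_nat.
Qed.

(** Pairing the terms of index 2j and 2j + 1 (in the usual numbering from 1),
    both at most (2j)^-q, compares a partial sum with its own first half. *)
Lemma sum_riemannR_double (R : realType) (q : R) (N : nat) : 0 <= q ->
  \sum_(0 <= n < N.*2.+1) riemannR q n
    <= 1 + 2 `^ (1 - q) * \sum_(0 <= n < N) riemannR q n.
Proof.
move=> q0; elim: N => [|N IH].
  by rewrite big_nat1 big_geq// /riemannR powR1 invr1 mulr0 addr0.
rewrite doubleS [leLHS]big_nat_recr//= [in leLHS]big_nat_recr//=.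
rewrite [in leRHS]big_nat_recr// mulrDr.
have two : 2 `^ (1 - q) * riemannR q N = 2 * riemannR q N.*2.+1.
  rewrite powRD ?pnatr_eq0 ?implybT// powRr1// -mulrA powRN; congr (_ * _).
  rewrite /riemannR (_ : N.*2.+2%:R = 2 * N.+1%:R); last first.
    by rewrite -doubleS -mul2n natrM.
  by rewrite powRM// invfM.
have next := nonincreasing_riemannR q0 (leqnSn N.*2.+1).
rewrite two; lra.
Qed.

(** With S the partial sum and r = 2^(1-q) < 1, the doubling estimate gives
    S <= 1 + r S. *)
Lemma sum_riemannR_le (R : realType) (q : R) (N : nat) : 1 < q ->
  \sum_(0 <= n < N) riemannR q n <= (1 - 2 `^ (1 - q))^-1.
Proof.
move=> q1; have q0 : 0 <= q by rewrite ltW// (lt_trans ltr01).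
have r1 : 2 `^ (1 - q) < 1 :> R.
  have one : 1 `^ (q - 1) = 1 :> R by rewrite powR1.
  rewrite -opprB powRN invf_lt1 ?powR_gt0// -[ltLHS]one.
  by rewrite gt0_ltr_powR ?subr_gt0 ?nnegrE// ltr1n.
have dbl := sum_riemannR_double N q0.
have mono : \sum_(0 <= n < N) riemannR q n <=
            \sum_(0 <= n < N.*2.+1) riemannR q n.
  rewrite [leRHS](@big_cat_nat _ _ _ N)//=; last first.
    by rewrite ltnW// ltnS -addnn leq_addr.
  by rewrite lerDl sumr_ge0// => n _; rewrite ltW// riemannR_gt0.
by rewrite -div1r ler_pdivlMr ?subr_gt0//; lra.
Qed.

(** * Sequences in the class S_q *)

(** A sequence of the class is easier to build from c_n = (1 / lambda_n)^q, since
    the main constraint on it is then linear in c. *)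
Lemma classS_of_summable (R : realType) (q C : R) (c : nat -> R) : 0 < q ->
  nonincreasing_seq c -> (forall n, riemannR q n <= c n) ->
  (forall N, \sum_(0 <= n < N) c n <= C) ->
  classS_ q (fun n => c n `^ (- q^-1)).
Proof.
move=> q0 c_dec c_ge c_sum.
have c0 n : 0 < c n by apply: lt_le_trans (c_ge n); rewrite riemannR_gt0// ltW.
have cV n : (c n `^ (- q^-1))^-1 = c n `^ q^-1 by rewrite powRN invrK.
have qV0 : 0 <= q^-1 by rewrite invr_ge0 ltW.
have L0 n : 0 < c n `^ (- q^-1) by rewrite powR_gt0.
split; first split.
- exact: L0.
- move=> m n mn; rewrite -lef_pV2 ?posrE// !cV.
  by rewrite ge0_ler_powR ?nnegrE ?(ltW (c0 _))//; exact: c_dec.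
- apply/cvgryPgt => A; near=> n.
  have [A0|A0] := leP A 0; first exact: le_lt_trans (L0 n).
  (* A summable monotone sequence is O(1/n), which is a rate for L n -> +oo. *)
  have nc : n.+1%:R * c n <= C.
    apply: le_trans (c_sum n.+1).
    rewrite mulr_natl -[X in _ *+ X]subn0 -sumr_const_nat.
    by apply: ler_sum_nat => i /andP[_ ilt]; exact: c_dec.
  have cA : c n < A `^ (- q).
    rewrite -(ltr_pM2l (ltr0Sn R n)) (le_lt_trans nc)// powRN.
    rewrite ltr_pdivlMr ?powR_gt0//.
    apply: (@lt_trans _ _ n%:R); last by rewrite ltr_nat.
    near: n; exact: nbhs_infty_gtr.
  rewrite -ltf_pV2 ?posrE// cV.
  have -> : A^-1 = (A `^ (- q)) `^ q^-1.
    by rewrite -powRrM mulNr mulfV ?gt_eqF// powR_inv1// ltW.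
  by rewrite gt0_ltr_powR ?invr_gt0// nnegrE ?powR_ge0// ltW.
- apply/eqP; rewrite -leye_eq -(nneseries_harmonic R); apply: lee_nneseries.
    by move=> n _ _; rewrite lee_fin invr_ge0.
  move=> n _; rewrite lee_fin cV.
  have -> : (n.+1%:R^-1 : R) = riemannR q n `^ q^-1.
    by rewrite /riemannR -powRN -powRrM mulNr mulfV ?gt_eqF// powR_inv1.
  rewrite ge0_ler_powR ?nnegrE//; [by rewrite ltW// riemannR_gt0// ltW|exact: ltW].
- apply: (@le_lt_trans _ _ C%:E); last exact: ltry.
  apply: nneseries_le_fin => [n|N]; first exact: powR_ge0.
  apply: le_trans (c_sum N); apply: ler_sum => n _.
  by rewrite cV -powRrM mulVf ?gt_eqF// powRr1// ltW.
Unshelve. all: by end_near.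
Qed.

(** This is an instance of the uniform boundedness principle on l^q, the dual of
    l^p: some functional is unbounded on a family of unbounded l^p norms. For
    sequences that are monotone, an explicit one has monotone coefficients. *)
Lemma exists_dual_weight (R : realType) (p q : R) (a : nat -> nat -> R)
    (N : nat -> nat) : 1 < p -> 1 < q -> p^-1 + q^-1 = 1 ->
  (forall k n, 0 <= a k n) ->
  (forall k m n, (m <= n < N k)%N -> a k n <= a k m) ->
  (forall k, (4 ^+ k.+1) `^ p <= \sum_(0 <= n < N k) a k n `^ p) ->
  exists2 L, classS_ q L &
    forall k, 2 ^+ k.+1 <= \sum_(0 <= n < N k) a k n / L n.
Proof.
move=> p1 q1 pq a0 a_dec a_big.
have p0 : 0 < p by exact: lt_trans p1.
have q0 : 0 < q by exact: lt_trans q1.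
pose A k := \sum_(0 <= n < N k) a k n `^ p.
have A0 k : 0 < A k.
  by apply: lt_le_trans (a_big k); rewrite powR_gt0// exprn_gt0.
(* The q-th power of the norming functional of the finite sequence a k. *)
pose d k n := if (n < N k)%N then a k n `^ p / A k else 0.
have d0 k n : 0 <= d k n.
  by rewrite /d; case: ifP => // _; rewrite divr_ge0 ?powR_ge0// ltW.
have d_sum k M : \sum_(0 <= n < M) d k n <= 1.
  apply: (@le_trans _ _ (\sum_(0 <= n < N k + M) d k n)).
    rewrite [leRHS](@big_cat_nat _ _ _ M)//= ?leq_addl//.
    by rewrite lerDl sumr_ge0.
  rewrite -big_mkcond/=.
  rewrite (eq_bigl (fun n => true && (n < N k)%N))// -big_nat_widen ?leq_addr//.
  by rewrite -mulr_suml -/(A k) divff// gt_eqF.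
have d_le1 k n : d k n <= 1.
  apply: le_trans (d_sum k n.+1).
  by rewrite big_nat_recr//= lerDr sumr_ge0.
have d_dec k : nonincreasing_seq (d k).
  move=> m n mn; rewrite /d; case: ifP => nN; last exact: d0.
  rewrite (leq_ltn_trans mn nN) ler_pM2r ?invr_gt0//.
  by rewrite ge0_ler_powR ?nnegrE ?(ltW p0)// a_dec// mn.
pose w k : R := 1 / (2 ^ k.+1)%:R.
have w0 k : 0 < w k by rewrite divr_gt0// ltr0n expn_gt0.
have w_sum : (\sum_(0 <= k <oo) (w k)%:E <= 1%:E)%E.
  exact: epsilon_trick0.
have wd0 k n : 0 <= w k * d k n by rewrite mulr_ge0// ltW.
pose g n := (\sum_(0 <= k <oo) (w k * d k n)%:E)%E.
have g_fin n : (g n \is a fin_num).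
  rewrite ge0_fin_numE; last by apply: nneseries_ge0 => k _ _; rewrite lee_fin.
  apply: (@le_lt_trans _ _ 1%:E); last exact: ltry.
  apply: le_trans w_sum; apply: lee_nneseries => k _; rewrite lee_fin//.
  by rewrite ler_piMr// ltW.
(* The second summand keeps c positive and makes the sum of the c n `^ q^-1
   diverge, even when the superposition g has few nonzero terms. *)
pose c n := fine (g n) + riemannR q n.
have g_sum M : \sum_(0 <= n < M) fine (g n) <= 1.
  rewrite -lee_fin -sumEFin.
  under eq_bigr do rewrite fineK//.
  rewrite /g -nneseries_sum_nat; last by move=> n k; rewrite lee_fin.
  apply: le_trans w_sum; apply: lee_nneseries => k _.
    by rewrite sume_ge0// => n _; rewrite lee_fin.
  by rewrite sumEFin lee_fin -mulr_sumr ler_piMr// ltW.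
have wd_le k n : w k * d k n <= c n.
  apply: (@le_trans _ _ (fine (g n))); last first.
    by rewrite lerDl ltW// riemannR_gt0// ltW.
  rewrite -lee_fin fineK//.
  apply: le_trans (sum_le_nneseries _ k.+1 _) => //.
  by rewrite lee_fin big_nat_recr//= lerDr sumr_ge0.
exists (fun n => c n `^ (- q^-1)).
  apply: (@classS_of_summable _ _ (1 + (1 - 2 `^ (1 - q))^-1)) => //.
  - move=> m n mn; apply: lerD; last exact: (nonincreasing_riemannR (ltW q0)).
    rewrite fine_le//; apply: lee_nneseries => k _; rewrite lee_fin//.
    by rewrite ler_pM2l// d_dec.
  - move=> n; rewrite lerDr fine_ge0//.
    by apply: nneseries_ge0 => k _ _; rewrite lee_fin.
  - by move=> M; rewrite big_split/= lerD// sum_riemannR_le.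
move=> k.
have qV0 : 0 <= q^-1 by rewrite invr_ge0 ltW.
(* Equality case of Hoelder's inequality for the k-th sequence alone. *)
have wA : \sum_(0 <= n < N k) a k n * (w k * d k n) `^ q^-1
    = w k `^ q^-1 * A k `^ p^-1.
  have -> : A k `^ p^-1 = A k * A k `^ (- q^-1).
    rewrite -{2}[A k](powRr1 (ltW (A0 k))) -powRD; last first.
      by rewrite (gt_eqF (A0 k)) implybT.
    by congr (_ `^ _); lra.
  set B := _ `^ (- _).
  rewrite mulrCA [X in _ = X * _]/A mulr_suml; apply: eq_big_nat => n /andP[_ nN].
  rewrite /d nN powRM ?divr_ge0 ?powR_ge0 ?ltW// powRM ?powR_ge0 ?invr_ge0 ?ltW//.
  have -> : (A k)^-1 `^ q^-1 = B.
    by rewrite -powR_inv1 ?ltW// -powRrM mulN1r.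
  rewrite -powRrM.
  have -> : p / q = p - 1.
    have : p * (p^-1 + q^-1) = p by rewrite pq mulr1.
    by rewrite mulrDr mulfV ?gt_eqF//; lra.
  by rewrite -(mulr_powRB1 (a0 k n) p0); ring.
apply: (@le_trans _ _ (w k `^ q^-1 * A k `^ p^-1)).
  apply: (@le_trans _ _ (w k * 4 ^+ k.+1)).
    (* The growth 4^(k+1) was chosen to outweigh the coefficient 2^-(k+1). *)
    rewrite /w div1r natrX -exprVn -exprMn.
    by rewrite (_ : 2^-1 * 4 = 2)//; lra.
  apply: ler_pM; rewrite ?(ltW (w0 _)) ?exprn_ge0//.
    apply: ger1_powR; last by rewrite invf_le1// ltW.
    by rewrite w0 /w div1r invf_le1 ?ler1n ?expn_gt0// ltr0n expn_gt0.
  rewrite -[leLHS]powRr1 ?exprn_ge0// -[X in _ `^ X <= _](@mulfV _ p) ?gt_eqF// powRrM.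
  by rewrite ge0_ler_powR ?nnegrE ?powR_ge0 ?invr_ge0 ?(ltW p0) ?(ltW (A0 k)).
rewrite -wA; apply: ler_sum_nat => n _.
rewrite powRN invrK ler_wpM2l// ge0_ler_powR ?nnegrE//.
exact: le_trans (wd_le k n).
Qed.

(** * Systems of intervals *)

(** A sum over intervals that does not depend on their order can be computed on
    a rearranged system, whereas the weights 1 / lambda_n pair best with
    increments listed in nonincreasing order. *)
Lemma sorted_finite_subsystem (R : realType) (f : R -> R) (I : interval_seq R)
    (M : nat) : nonoverlapping_in_period I ->
  exists J : interval_seq R, exists N : nat,
    [/\ nonoverlapping_in_period J, len J = Some N,
        forall m n, (m <= n < N)%N -> `|incr f J n| <= `|incr f J m| &
        forall F : R -> R, \sum_(0 <= n < N) F `|incr f J n| =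
          \sum_(0 <= n < M | in_range (len I) n) F `|incr f I n|].
Proof.
move=> [lt_lr triv [c sub_c]].
pose ge i j := `|incr f I j| <= `|incr f I i|.
pose s := sort ge [seq n <- index_iota 0 M | in_range (len I) n].
pose J := IntervalSeq (Some (size s)) (fun n => lpt I (nth 0%N s n))
  (fun n => rpt I (nth 0%N s n)).
have s_uniq : uniq s by rewrite sort_uniq filter_uniq// iota_uniq.
have in_s n : (n < size s)%N -> in_range (len I) (nth 0%N s n).
  by move=> /(mem_nth 0%N); rewrite mem_sort mem_filter => /andP[].
exists J, (size s); split => //.
- split => /=.
  + by move=> n /in_s; exact: lt_lr.
  + move=> i j /= ilt jlt; move=> /(triv _ _ (in_s _ ilt) (in_s _ jlt))/eqP.
    by rewrite nth_uniq// => /eqP.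
  + by exists c => n /in_s; exact: sub_c.
- move=> m n /andP[mn nN].
  have ge_tr : transitive ge by move=> j i k ij jk; exact: le_trans jk ij.
  apply: (sorted_leq_nth ge_tr) => //; rewrite ?inE//.
  + by move=> i; exact: lexx.
  + by apply: sort_sorted => i j; exact: le_total.
  + exact: leq_ltn_trans nN.
- move=> F; rewrite -[RHS]big_filter [RHS](perm_big s) /=; last by rewrite perm_sym perm_sort.
  by rewrite [RHS](big_nth 0%N).
Qed.

(** Young's inequality term by term, with bounds for both resulting sums that do
    not depend on the system of intervals. *)
Lemma V_sub_LambdaBV (R : realType) (p q : R) (L : nat -> R) (f : R -> R) :
  0 < p -> 0 < q -> p^-1 + q^-1 = 1 -> classS_ q L ->
  (v_p p f < +oo)%E -> (v_Lambda L f < +oo)%E.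
Proof.
move=> p0 q0 pq [[L0 _ _ _]]; set S := (\sum_(0 <= n <oo) _)%E => S_lt v_lt.
have LV0 n : 0 <= (L n)^-1 by rewrite invr_ge0 ltW.
apply: (@le_lt_trans _ _ (p^-1%:E * v_p p f `^ p + q^-1%:E * S)%E); last first.
  by rewrite lte_add_pinfty// lte_mul_pinfty ?lee_fin ?invr_ge0 ?ltW// poweR_lty.
apply: ge_ereal_sup => _ [I nI <-].
pose a n : R := `|incr f I n|.
have young n : ((a n / L n)%:E <=
    p^-1%:E * (a n `^ p)%:E + q^-1%:E * ((L n)^-1 `^ q)%:E)%E.
  rewrite -!EFinM -EFinD lee_fin ![_^-1 * (_ `^ _)]mulrC.
  exact: (conjugate_powR (normr_ge0 _) (LV0 n) p0 q0 pq).
have powR0 (x r : R) : (0 <= (x `^ r)%:E)%E by rewrite lee_fin powR_ge0.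
apply: (@le_trans _ _ (\sum_(0 <= n <oo | in_range (len I) n)
    (p^-1%:E * (a n `^ p)%:E + q^-1%:E * ((L n)^-1 `^ q)%:E))%E).
  apply: lee_nneseries => n _; last exact: young.
  by rewrite lee_fin mulr_ge0.
rewrite nneseriesD; last 2 first.
- by move=> n _ _; rewrite mule_ge0// lee_fin invr_ge0 ltW.
- by move=> n _ _; rewrite mule_ge0// lee_fin invr_ge0 ltW.
rewrite !nneseriesZl//.
apply: leeD; apply: lee_wpmul2l; rewrite ?lee_fin ?invr_ge0 ?(ltW p0) ?(ltW q0)//.
- set T := (X in (X <= _)%E).
  have T0 : (0 <= T)%E by apply: nneseries_ge0.
  have T_le : (T `^ p^-1 <= v_p p f)%E.
    by apply: ereal_sup_ubound; exists I.
  rewrite -[leLHS]poweRe1// -(@mulVf _ p) ?gt_eqF// poweRrM.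
  apply: gt0_ler_poweR => //; first exact: ltW.
    by rewrite in_itv/= leey poweR_ge0.
  by rewrite in_itv/= leey (le_trans _ T_le) ?poweR_ge0.
- rewrite eseries_mkcond; apply: lee_nneseries => n _.
    by case: ifP.
  by case: ifP.
Qed.

(** The supremum defining the p-variation is approached by finite systems, which
    may be sorted. *)
Lemma large_p_sum (R : realType) (p K : R) (f : R -> R) : 0 < p ->
  ~ (v_p p f < +oo)%E ->
  exists J : interval_seq R, exists N : nat,
    [/\ nonoverlapping_in_period J, len J = Some N,
        forall m n, (m <= n < N)%N -> `|incr f J n| <= `|incr f J m| &
        K <= \sum_(0 <= n < N) `|incr f J n| `^ p].
Proof.
move=> p0; apply: contra_notP => noJ.
apply: (@le_lt_trans _ _ (K%:E `^ p^-1)%E); last by rewrite poweR_EFin ltry.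
apply: ge_ereal_sup => _ [I nI <-].
set S := (\sum_(0 <= n <oo | _) _)%E.
have S0 : (0 <= S)%E by apply: nneseries_ge0 => n _ _; rewrite lee_fin powR_ge0.
have SK : (S <= K%:E)%E.
  apply: nneseries_le_fin => [n|M]; first exact: powR_ge0.
  have [J [N [nJ lenJ J_dec J_sum]]] := sorted_finite_subsystem f M nI.
  rewrite -(J_sum (fun x => x `^ p)) leNgt; apply/negP => K_lt.
  by apply: noJ; exists J, N; split => //; exact: ltW.
apply: gt0_ler_poweR => //; first by rewrite invr_ge0 ltW.
- by rewrite in_itv/= S0 leey.
- by rewrite in_itv/= leey (le_trans S0).
Qed.

(** * V_p as an intersection of Lambda BV classes *)

Theorem theorem4p1 (R : realType) (p p' : R) (hp : 1 < p)
    (hp' : p' = p / (p - 1)) :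
  V_ p = \bigcap_(L in classS_ p') LambdaBV L.
Proof.
have p0 : 0 < p by exact: lt_trans hp.
have p10 : 0 < p - 1 by rewrite subr_gt0.
have q1 : 1 < p' by rewrite hp' ltr_pdivlMr// mul1r gtrBl.
have q0 : 0 < p' by exact: lt_trans q1.
have pq : p^-1 + p'^-1 = 1.
  by rewrite hp' invf_div -{1}(div1r p) -mulrDl addrC subrK mulfV ?gt_eqF.
apply/seteqP; split => f.
  by move=> [f_per f_V] L SL; split => //; exact: (V_sub_LambdaBV p0 q0 pq SL f_V).
move=> f_BV; split.
  (* Periodicity is read off from any member of the class, such as lambda_n = n + 1. *)
  have [] // := f_BV (fun n => riemannR p' n `^ (- p'^-1)).
  apply: (@classS_of_summable _ _ (1 - 2 `^ (1 - p'))^-1) => // [|N].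
    by apply: nonincreasing_riemannR; exact: ltW.
  exact: sum_riemannR_le.
apply: contrapT => v_oo.
have /choice[J /choice[N JN]] k := large_p_sum ((4 ^+ k.+1) `^ p) p0 v_oo.
have [||k|L SL L_big] := @exists_dual_weight _ p p'
  (fun k n => `|incr f (J k) n|) N hp q1 pq.
- by [].
- by move=> k; have [] := JN k.
- by have [] := JN k.
have [_ v_lt] := f_BV L SL.
have [[L0 _ _ _] _] := SL.
have v_ge k : ((2 ^+ k.+1)%:E <= v_Lambda L f)%E.
  have [nJ lenJ _ _] := JN k.
  apply: (@le_trans _ _ (\sum_(0 <= n <oo | in_range (len (J k)) n)
      (`|incr f (J k) n| / L n)%:E)%E); last first.
    by apply: ereal_sup_ubound; exists (J k).
  apply: le_trans (sum_le_nneseries _ (N k) _); last first.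
    by move=> n; rewrite divr_ge0// ltW.
  rewrite lee_fin (le_trans (L_big k))// lenJ /= big_nat_cond [leRHS]big_nat_cond.
  rewrite le_eqVlt; apply/orP; left; apply/eqP; apply: eq_bigl => n.
  by rewrite leq0n /= andbT andbb.
have v0 : (0 <= v_Lambda L f)%E by apply: le_trans (v_ge 0%N); rewrite lee_fin.
have v_fin : v_Lambda L f \is a fin_num by rewrite ge0_fin_numE.
have := archi_boundP (fine_ge0 v0); set k := Num.bound _.
apply/negP; rewrite -leNgt -lee_fin fineK//; apply: le_trans (v_ge k).
by rewrite lee_fin -natrX ler_nat ltnW// (leq_trans (ltn_expl k (ltnSn 1)))// leq_exp2l.
Qed.
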